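(* For integers $k\ge1$ let $c^{(k)}_{l,m}$ ($1\le l,m\le k$) be the unique coefficients with $(xy)^{\underline{k}} = \sum_{l,m=1}^k c^{(k)}_{l,m}\, x^{\underline{l}}\, y^{\underline{m}}$, and set $c^{(k)}_{l,m}=0$ whenever $l$ or $m$ lies outside $\{1,\dots,k\}$. Then for all integers $k\ge1$ and $0\le l,m\le k$, \[ c^{(k+1)}_{l+1,m+1} = c^{(k)}_{l,m}+(l+1)c^{(k)}_{l+1,m}+(m+1)c^{(k)}_{l,m+1}+\big((l+1)(m+1)-k\big)c^{(k)}_{l+1,m+1}. \]
   Context: $x^{\underline{n}}=x(x-1)\cdots(x-n+1)$ is the falling factorial power. *)

(* Defs.v *)
From HB Require Import structures.
From mathcomp Require Export all_boot all_order all_algebra.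

Set Implicit Arguments.
Unset Strict Implicit.
Unset Printing Implicit Defensive.

Import GRing.Theory.
Local Open Scope ring_scope.

(* The falling power a (a - 1) ... (a - n + 1) in an arbitrary ring; binomial.v
   only provides it on nat, as n ^_ m. *)
Definition falling (A : pzRingType) (a : A) (n : nat) : A :=
  \prod_(i < n) (a - i%:R).

(* R[x, y] is represented as {poly {poly R}}. *)
Definition polyx (R : comNzRingType) : {poly {poly R}} := 'X%:P.
Definition polyy (R : comNzRingType) : {poly {poly R}} := 'X.

(* The family is indexed by all of nat * nat, so the convention that it vanishes
   off {1, ..., k}^2 is part of the specification. *)
Definition product_coefs (R : comNzRingType) (k : nat) (c : nat -> nat -> R)
  : Prop :=
  falling (polyx R * polyy R) k =
    \sum_(1 <= l < k.+1) \sum_(1 <= m < k.+1)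
      (c l m)%:P%:P * falling (polyx R) l * falling (polyy R) m
  /\ (forall l m : nat,
        ~ ((1 <= l <= k)%N /\ (1 <= m <= k)%N) -> c l m = 0).

(* Main.v *)
(** Since [x^(l) * x = x^(l+1) + l x^(l)] for the falling power [x^(l)],
    multiplying [sum_l a_l x^(l)] by [x] turns the coefficients [a] into
    [l |-> a_(l-1) + l a_l].  Applying this in both variables to
    [(xy)^(k+1) = (xy)^(k) (xy - k)] yields coefficients that satisfy the
    recurrence; they are the only ones because falling powers of ['X] are
    monic of every degree, hence linearly independent. *)
Require Import Defs.
From mathcomp Require Import all_boot all_order all_algebra.
From mathcomp Require Import ring.

Set Implicit Arguments.
Unset Strict Implicit.
Unset Printing Implicit Defensive.

Import GRing.Theory.
Local Open Scope ring_scope.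

Lemma falling0 (A : pzRingType) (a : A) : falling a 0 = 1.
Proof. by rewrite /falling big_ord0. Qed.

Lemma fallingS (A : pzRingType) (a : A) n :
  falling a n.+1 = falling a n * (a - n%:R).
Proof. by rewrite /falling big_ord_recr. Qed.

Lemma rmorph_falling (A B : pzRingType) (f : {rmorphism A -> B}) a n :
  f (falling a n) = falling (f a) n.
Proof.
elim: n => [|n IHn]; first by rewrite !falling0 rmorph1.
by rewrite !fallingS rmorphM IHn rmorphB rmorph_nat.
Qed.

Lemma fallingX_prod (S : comNzRingType) n :
  falling ('X : {poly S}) n = \prod_(i < n) ('X - (i%:R)%:P).
Proof. by apply: eq_bigr => i _; rewrite polyC_natr. Qed.

Lemma size_fallingX (S : comNzRingType) n :
  size (falling ('X : {poly S}) n) = n.+1.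
Proof.
by rewrite fallingX_prod size_prod_XsubC -sum1_size sum1_card card_ord.
Qed.

Lemma coef_fallingX (S : comNzRingType) n :
  (falling ('X : {poly S}) n)`_n = 1.
Proof.
have /monicP <- : falling ('X : {poly S}) n \is monic.
  by rewrite fallingX_prod monic_prod_XsubC.
by rewrite lead_coefE size_fallingX.
Qed.

(** Only the last term reaches the top degree, and its falling power is monic, so its coefficient
    vanishes over any commutative ring; induction handles the rest. *)
Lemma fallingX_free (S : comNzRingType) n (a : nat -> S) :
  \sum_(l < n) (a l)%:P * falling 'X l = 0 ->
  forall l, (l < n)%N -> a l = 0.
Proof.
elim: n => // n IHn; rewrite big_ord_recr /= => sum0.
have an0 : a n = 0.
  have := congr1 (fun p : {poly S} => p`_n) sum0.
  rewrite coefD coefCM coef_fallingX mulr1 coef0 coef_sum big1 ?add0r // => i _.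
  by rewrite coefCM nth_default ?mulr0 // size_fallingX.
move: sum0; rewrite an0 mul0r addr0 => /IHn an l.
by rewrite ltnS leq_eqVlt => /predU1P[-> // | /an].
Qed.

(** The [else] branch stands for a zero coefficient at index -1. *)
Definition xshift (A : pzSemiRingType) (a : nat -> A) (l : nat) : A :=
  (if l is l'.+1 then a l' else 0) + l%:R * a l.

Lemma eq_xshift (A : pzSemiRingType) (a b : nat -> A) :
  a =1 b -> xshift a =1 xshift b.
Proof. by move=> ab [|l]; rewrite /xshift !ab. Qed.

Lemma rmorph_xshift (A B : pzSemiRingType) (f : {rmorphism A -> B}) a l :
  f (xshift a l) = xshift (f \o a) l.
Proof.
by case: l => [|l]; rewrite rmorphD rmorphM rmorph_nat //= rmorph0.
Qed.

(** Linearity of [xshift], needed when the coefficients in [x] are themselves expansions in [y]. *)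
Lemma xshift_sum (A : comPzRingType) n (a : nat -> nat -> A) (y : nat -> A) l :
  xshift (fun i => \sum_(m < n) a i m * y m) l
  = \sum_(m < n) xshift (a^~ m) l * y m.
Proof.
case: l => [|l]; rewrite /xshift ?add0r mulr_sumr -?big_split /=.
  by apply: eq_bigr => i _; rewrite add0r mulrA.
by apply: eq_bigr => i _; rewrite mulrDl mulrA.
Qed.

Lemma falling_sum_mul (A : comPzRingType) (x : A) n (a : nat -> A) :
  a n = 0 ->
  (\sum_(l < n) a l * falling x l) * x
  = \sum_(l < n.+1) xshift a l * falling x l.
Proof.
move=> an0; rewrite /xshift.
under [RHS]eq_bigr do rewrite mulrDl.
(* The shifted part loses its zero term at index 0 and the other part its term at [n], where
   [a n = 0]; both then run over [n] indices. *)
rewrite big_split /= big_ord_recl mul0r add0r [X in _ = _ + X]big_ord_recr /=.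
rewrite an0 mulr0 mul0r addr0 -big_split mulr_suml.
by apply: eq_bigr => i _; rewrite /= /bump add1n fallingS; ring.
Qed.

(** The recursion starts from the empty product 1, placed at index (0, 0). The ring is a parameter
    so that the same table can be read in [R] and in [{poly {poly R}}]. *)
Fixpoint prodcoef (A : pzRingType) (k l m : nat) : A :=
  if k is k'.+1 then
    xshift (fun i => xshift (prodcoef A k' i) m) l - k'%:R * prodcoef A k' l m
  else ((l == 0) && (m == 0))%:R.

Lemma rmorph_prodcoef (A B : pzRingType) (f : {rmorphism A -> B}) k l m :
  f (prodcoef A k l m) = prodcoef B k l m.
Proof.
elim: k l m => [|k IHk] l m /=; first by rewrite rmorph_nat.
rewrite rmorphB rmorphM rmorph_nat IHk rmorph_xshift; congr (_ - _).
apply: eq_xshift => i /=; rewrite rmorph_xshift.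
by apply: eq_xshift => j /=.
Qed.

(** Each multiplication by [x * y - k] raises either index by at most one. *)
Lemma prodcoef_gt (A : pzRingType) k l m :
  (k < l)%N || (k < m)%N -> prodcoef A k l m = 0.
Proof.
elim: k l m => [|k IHk] l m klm; first by case: l m klm => [|l] [].
have z i j : (l <= i.+1)%N -> (m <= j.+1)%N -> prodcoef A k i j = 0.
  move=> li mj; apply: IHk; case/orP: klm => [kl | km].
    by rewrite -ltnS (leq_trans kl).
  by rewrite -[(k < j)%N]ltnS (leq_trans km) ?orbT.
rewrite /= (z l m) // mulr0 subr0.
by case: l m {klm} z => [|l] [|m] z; rewrite /xshift !z ?(mulr0, addr0).
Qed.

(** At index 0 a shift returns [0 * a 0], so only the term with factor [-k] survives; that factor is
    0 in the first step, and induction gives the later ones. *)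
Lemma prodcoef_eq0 (A : pzRingType) k l m :
  (l == 0)%N || (m == 0)%N -> prodcoef A k.+1 l m = 0.
Proof.
move=> lm0.
have x0 (a : nat -> nat -> A) : xshift (fun i => xshift (a i) m) l = 0.
  case/orP: lm0 => /eqP->; first by rewrite /xshift mul0r addr0.
  by case: l => [|l]; rewrite /xshift !mul0r ?(addr0, mulr0).
by elim: k => [|k IHk]; rewrite /= x0 sub0r ?mul0r ?[_ - _]IHk ?mulr0 oppr0.
Qed.

Lemma prodcoefSS (A : comPzRingType) k l m :
  prodcoef A k.+1 l.+1 m.+1 =
    prodcoef A k l m + l.+1%:R * prodcoef A k l.+1 m
    + m.+1%:R * prodcoef A k l m.+1
    + (l.+1%:R * m.+1%:R - k%:R) * prodcoef A k l.+1 m.+1.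
Proof. by rewrite /= /xshift; ring. Qed.

Lemma falling_mul (A : comPzRingType) (x y : A) k :
  falling (x * y) k =
    \sum_(l < k.+1)
      (\sum_(m < k.+1) prodcoef A k l m * falling y m) * falling x l.
Proof.
elim: k => [|k IHk]; first by rewrite !big_ord1 !falling0 !mulr1.
pose s n l := \sum_(m < n) prodcoef A k l m * falling y m.
have s0 n : s n k.+1 = 0.
  by rewrite /s big1 // => i _; rewrite prodcoef_gt ?ltnSn ?mul0r.
have sS l : s k.+1 l = s k.+2 l.
  by rewrite /s [RHS]big_ord_recr /= prodcoef_gt ?ltnSn ?orbT // mul0r addr0.
(* Both ranges are padded with zero terms, so that [k] times this sum can be subtracted termwise. *)
have widen : falling (x * y) k = \sum_(l < k.+2) s k.+2 l * falling x l.
  rewrite big_ord_recr /= s0 mul0r addr0 IHk.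
  by apply: eq_bigr => l _; rewrite -sS.
have mul_y : falling (x * y) k * y = \sum_(l < k.+1)
    (\sum_(m < k.+2) xshift (prodcoef A k l) m * falling y m) * falling x l.
  rewrite IHk mulr_suml; apply: eq_bigr => l _.
  by rewrite mulrAC falling_sum_mul // prodcoef_gt ?ltnSn ?orbT.
(* The factor [y] is multiplied in first, inside each coefficient, and then [x] on the outer sum. *)
rewrite fallingS mulrBr mulrA mulrAC mul_y.
rewrite [_ * k%:R]mulrC widen (falling_sum_mul _ (a := fun l =>
  \sum_(m < k.+2) xshift (prodcoef A k l) m * falling y m)); last first.
  apply: big1 => i _.
  by rewrite /xshift; case: (nat_of_ord i) => [|j];
    rewrite !prodcoef_gt ?ltnSn // ?mulr0 ?addr0 mul0r.
rewrite mulr_sumr -sumrB; apply: eq_bigr => l _.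
rewrite (xshift_sum _ (fun i => xshift (prodcoef A k i)) (falling y)).
rewrite mulrA -mulrBl mulr_sumr -sumrB; congr (_ * _).
by apply: eq_bigr => m _; rewrite mulrA -mulrBl.
Qed.

(** Existence and uniqueness at once. The index is [k.+1] because for 0 the double sum is empty
    while the falling power is 1. *)
Lemma product_coefsP (R : comNzRingType) k (c : nat -> nat -> R) :
  product_coefs k.+1 c <-> c =2 prodcoef R k.+1.
Proof.
have supp0 l m : ~ ((1 <= l <= k.+1)%N /\ (1 <= m <= k.+1)%N) ->
    prodcoef R k.+1 l m = 0.
  move=> nlm; have [/prodcoef_eq0-> // |] := boolP ((l == 0) || (m == 0))%N.
  rewrite negb_or -!lt0n => /andP[l_gt0 m_gt0].
  rewrite prodcoef_gt // !ltnNge -negb_and; apply/negP => /andP[lk mk].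
  by apply: nlm; rewrite l_gt0 m_gt0.
(* The double sum as a polynomial in [y], with the zero terms of index 0. *)
have sumE (d : nat -> nat -> R) :
    (forall l m, ~ ((1 <= l <= k.+1)%N /\ (1 <= m <= k.+1)%N) -> d l m = 0) ->
    \sum_(1 <= l < k.+2) \sum_(1 <= m < k.+2)
      (d l m)%:P%:P * falling (polyx R) l * falling (polyy R) m
    = \sum_(m < k.+2)
        (\sum_(l < k.+2) (d l m)%:P * falling 'X l)%:P * falling 'X m.
  move=> d0.
  have d0m m : d 0 m = 0 by apply: d0 => -[].
  have dl0 l : d l 0 = 0 by apply: d0 => -[].
  rewrite exchange_big -[RHS](big_mkord xpredT (fun m =>
    (\sum_(l < k.+2) (d l m)%:P * falling 'X l)%:P * falling 'X m)) /=.
  rewrite [RHS]big_ltn // [X in X%:P]big1 ?polyC0 ?mul0r ?add0r; last first.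
    by move=> l _; rewrite dl0 polyC0 mul0r.
  apply: eq_bigr => m _; rewrite -mulr_suml; congr (_ * _).
  rewrite -(big_mkord xpredT (fun l => (d l m)%:P * falling 'X l)).
  rewrite [in RHS]big_ltn // d0m polyC0 mul0r add0r rmorph_sum.
  by apply: eq_bigr => l _; rewrite rmorphM rmorph_falling.
have prodE : falling (polyx R * polyy R) k.+1 =
    \sum_(1 <= l < k.+2) \sum_(1 <= m < k.+2)
      (prodcoef R k.+1 l m)%:P%:P * falling (polyx R) l * falling (polyy R) m.
  rewrite sumE // falling_mul.
  under eq_bigr do rewrite mulr_suml.
  rewrite exchange_big; apply: eq_bigr => m _.
  rewrite rmorph_sum mulr_suml; apply: eq_bigr => l _.
  rewrite rmorphM rmorph_falling mulrAC.
  (* The coefficients computed in [{poly {poly R}}] are the constants coming from [R]. *)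
  by rewrite (rmorph_prodcoef (@polyC R)) (rmorph_prodcoef (@polyC {poly R})).
split=> [[cE c0] l m | cE]; last first.
  split=> [|l m]; last by rewrite cE; apply: supp0.
  by rewrite prodE; apply: eq_bigr => l _; apply: eq_bigr => m _; rewrite cE.
have [/andP[lk mk]|nlm] := boolP ((l < k.+2)%N && (m < k.+2)%N); last first.
  have nlm' : ~ ((1 <= l <= k.+1)%N /\ (1 <= m <= k.+1)%N).
    by case=> /andP[_ lk] /andP[_ mk]; rewrite !ltnS lk mk in nlm.
  by rewrite c0 // supp0.
apply/eqP; rewrite -subr_eq0; apply/eqP.
(* Independence is used twice, backwards: over [R] for the powers in [x], then over [{poly R}] for
   those in [y]. It remains to see that the difference of the two expansions is zero. *)
apply: (fallingX_free (n := k.+2)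
          (a := fun l => c l m - prodcoef R k.+1 l m)) lk.
apply: (fallingX_free (n := k.+2) (a := fun m =>
  \sum_(l < k.+2) (c l m - prodcoef R k.+1 l m)%:P * falling 'X l)) mk.
rewrite -(sumE (fun l m => c l m - prodcoef R k.+1 l m)); last first.
  by move=> i j ij; rewrite c0 // supp0 // subr0.
under eq_bigr do under eq_bigr do rewrite 2!polyCB 2!mulrBl.
under eq_bigr do rewrite sumrB.
by rewrite sumrB -cE -prodE subrr.
Qed.

Theorem theorem1 (R : comNzRingType) :
  (forall k : nat, (1 <= k)%N ->
     exists2 c : nat -> nat -> R, product_coefs k c &
       forall c' : nat -> nat -> R, product_coefs k c' -> c' =2 c)
  /\
  (forall c : nat -> nat -> nat -> R,
     (forall k : nat, (1 <= k)%N -> product_coefs k (c k)) ->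
     forall k l m : nat, (1 <= k)%N -> (l <= k)%N -> (m <= k)%N ->
       c k.+1 l.+1 m.+1 =
         c k l m + l.+1%:R * c k l.+1 m + m.+1%:R * c k l m.+1
         + (l.+1%:R * m.+1%:R - k%:R) * c k l.+1 m.+1).
Proof.
split=> [[|k] // _ | c cP [|k] // l m _ _ _].
  by exists (prodcoef R k.+1) => [|c' /product_coefsP //]; apply/product_coefsP.
have cE i : c i.+1 =2 prodcoef R i.+1 by apply/product_coefsP/cP.
by rewrite !cE prodcoefSS.
Qed.
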